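(* Let $0<\lambda<\tfrac12$, let $F_\lambda$ be the middle-$(1-2\lambda)$ Cantor set, let $F_\lambda^2=\{x^2:x\in F_\lambda\}$, and let $$D=\left\{\frac{x_1^2}{x_2}: x_1,x_2\in F_\lambda,\ x_2\neq 0\right\},\qquad K=\{k\ge 0: k\notin D\}.$$ Then: (i) $F_\lambda^2$ is not a self-similar set; (ii) if $\tfrac13\le\lambda<\tfrac12$, then $K=\emptyset$, i.e. $D=[0,+\infty)$; (iii) if $\tfrac{2-\sqrt2}{2}\le\lambda<\tfrac12$, then $D$ contains a closed interval of positive length.
   Context: For $0<\lambda<\tfrac12$, $F_\lambda\subset[0,1]$ is the unique nonempty compact set (attractor) satisfying $F_\lambda=f_0(F_\lambda)\cup f_1(F_\lambda)$, where $f_0(x)=\lambda x$ and $f_1(x)=\lambda x+(1-\lambda)$. A compact set $E\subset\mathbb R$ is self-similar if it is the attractor of a finite family (with at least two maps) of contracting similarities $x\mapsto r_ix+b_i$, $0<|r_i|<1$. The set $K$ is the set of slopes $k\ge 0$ for which the ray $y=kx$, $x>0$, does not meet $F_\lambda\times F_\lambda^2$. *)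

(* Defs.v *)
From HB Require Import structures.
From mathcomp Require Import all_boot all_order all_algebra.
From mathcomp Require Import all_classical all_reals all_analysis.
Set Implicit Arguments. Unset Strict Implicit. Unset Printing Implicit Defensive.
Import Order.TTheory GRing.Theory Num.Theory.
Import numFieldNormedType.Exports.
Local Open Scope classical_set_scope.
Local Open Scope ring_scope.

Definition simap {R : realType} (p : R * R) (x : R) : R := p.1 * x + p.2.

Definition hutch {R : realType} (fs : seq (R * R)) (E : set R) : set R :=
  [set y | exists2 p, p \in fs & exists2 x, E x & y = simap p x].

(* E is the attractor of the family fs: the (by Hutchinson, unique)
   nonempty compact set with E = \bigcup_i f_i(E). *)
Definition is_attractor {R : realType} (fs : seq (R * R)) (E : set R) : Prop :=
  E !=set0 /\ compact E /\ E = hutch fs E.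

Definition self_similar {R : realType} (E : set R) : Prop :=
  exists fs : seq (R * R),
    (2 <= size fs)%N /\ (forall p, p \in fs -> 0 < `|p.1| < 1) /\
    is_attractor fs E.

Definition cantor_ifs {R : realType} (lam : R) : seq (R * R) :=
  [:: (lam, 0); (lam, 1 - lam)].

(* F_lam: the unique attractor of cantor_ifs lam, defined as the set of
   points lying in every attractor (which, by uniqueness, is that attractor). *)
Definition cantorF {R : realType} (lam : R) : set R :=
  [set x | forall E, is_attractor (cantor_ifs lam) E -> E x].

Definition cantorF2 {R : realType} (lam : R) : set R :=
  [set x ^+ 2 | x in cantorF lam].

Definition setD_lam {R : realType} (lam : R) : set R :=
  [set y | exists x1 x2, [/\ cantorF lam x1, cantorF lam x2, x2 != 0 &
                            y = x1 ^+ 2 / x2]].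

Definition setK_lam {R : realType} (lam : R) : set R :=
  [set k | 0 <= k /\ ~ setD_lam lam k].

(* Main.v *)
Require Import Defs.
From HB Require Import structures.
From mathcomp Require Import all_boot all_order all_algebra.
From mathcomp Require Import all_classical all_reals all_analysis.
From mathcomp Require Import ring lra.
Set Implicit Arguments. Unset Strict Implicit. Unset Printing Implicit Defensive.
Import Order.TTheory GRing.Theory Num.Theory.
Import numFieldNormedType.Exports.
Local Open Scope classical_set_scope.
Local Open Scope ring_scope.

(** Write [F] for the Cantor set and [E] for the set of its squares.

    (i) The central gap of the squared cylinder [[c ^ 2, (c + h) ^ 2]] has
    relative length exactly [1 - 2 * lam], and the longest gap of [E], of
    length [1 - 2 * lam], is [(lam ^ 2, (1 - lam) ^ 2)] only.  If a similarity
    maps [E] into itself and covers [1], its image straddles the central gap of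
    some squared cylinder [[(1 - h) ^ 2, 1]]; comparing gaps, the similarity must
    carry the hull of [E] onto that cylinder and the longest gap onto the central
    one, whose position inside the cylinder is wrong unless [h = 1].

    (ii), (iii) If on every square of a region the images of the four corner
    squares under [x ^ 2 / y] overlap, then [x ^ 2 / y] maps the product of the
    Cantor cylinders onto the same interval as the full square.  For
    [1/3 <= lam] this applies to [[1 - lam, 1]], and the resulting interval
    together with the invariance of [D] under multiplication by [lam] and its
    inverse gives everything; for smaller [lam] it applies close to
    [(1, 1)]. *)

(** * Geometric approximation in compact sets *)

Lemma expr_lt_eps (R : realType) (q e : R) :
  0 < q < 1 -> 0 < e -> exists n, q ^+ n < e.
Proof.
move=> /andP[q0 q1] e0.
have qlt : `|q| < 1 by rewrite gtr0_norm.
have /cvgrPdist_lt/(_ _ e0)[n _ /(_ n (leqnn n))/=] := cvg_expr qlt.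
by rewrite sub0r normrN ger0_norm ?exprn_ge0 1?ltW// => ?; exists n.
Qed.

(** Turns solutions up to an error of order [q ^+ n], for every [n], into exact ones. It serves both
    the minimality of the attractor and the surjectivity of [x ^ 2 / y]. *)
Lemma compact_expr_approx (R : realType) (A : set R) (q C x : R) :
    0 < q < 1 -> compact A ->
    (forall n, exists2 y, A y & `|x - y| <= C * q ^+ n) ->
  A x.
Proof.
move=> q01 cA apx; apply: (compact_closed (@norm_hausdorff _ R^o) cA).
move=> B /nbhs_ballP[e /= e0 Be].
have C0 : 0 < `|C| + 1 by rewrite ltr_pwDr.
have [n qn] := expr_lt_eps q01 (divr_gt0 e0 C0).
have [y Ay xy] := apx n; exists y; split=> //; apply: Be.
rewrite /ball /= (le_lt_trans xy)//.
rewrite ltr_pdivlMr// mulrC in qn; apply: le_lt_trans qn.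
have /andP[/ltW q0 _] := q01; rewrite ler_wpM2r ?exprn_ge0//.
by rewrite (le_trans (ler_norm _))// lerDl.
Qed.

(** * The Cantor set as an attractor *)

Lemma continuous_simap (R : realType) (p : R * R) : continuous (simap p).
Proof.
by move=> x; apply: cvgD; [apply: cvgM; [exact: cvg_cst|exact: cvg_id]|exact: cvg_cst].
Qed.

Lemma hutch_cantorE (R : realType) (lam : R) (S : set R) :
  hutch (cantor_ifs lam) S
  = simap (lam, 0) @` S `|` simap (lam, 1 - lam) @` S.
Proof.
rewrite predeqE => y; split.
  by case=> p; rewrite !inE => /orP[]/eqP-> [x Sx ->]; [left|right]; exists x.
by case=> -[x Sx <-]; [exists (lam, 0)|exists (lam, 1 - lam)];
  rewrite ?inE ?eqxx ?orbT//; exists x.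
Qed.

Lemma compact_hutch_cantor (R : realType) (lam : R) (S : set R) :
  compact S -> compact (hutch (cantor_ifs lam) S).
Proof.
move=> cS; rewrite hutch_cantorE.
by apply: compactU; apply: continuous_compact cS;
  apply: continuous_subspaceT; apply: continuous_simap.
Qed.

(* The attractor as a greatest fixed point: membership is proved by coinduction. *)
Definition cantor_gfp (R : realType) (lam : R) : set R :=
  [set x | exists S : set R,
     [/\ S `<=` `[0, 1], S `<=` hutch (cantor_ifs lam) S & S x]].

Lemma hutchS (R : realType) (fs : seq (R * R)) (S T : set R) :
  S `<=` T -> hutch fs S `<=` hutch fs T.
Proof. by move=> ST y [p pfs [x Sx ->]]; exists p => //; exists x => //; apply: ST. Qed.

Lemma cantor_gfp_sub01 (R : realType) (lam : R) : @cantor_gfp R lam `<=` `[0, 1].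
Proof. by move=> x [S [S01 _]] /S01. Qed.

Lemma cantor_gfp_fix (R : realType) (lam : R) : 0 < lam < 2^-1 ->
  @cantor_gfp R lam = hutch (cantor_ifs lam) (cantor_gfp lam).
Proof.
move=> /andP[l0 l1].
have sub : @cantor_gfp R lam `<=` hutch (cantor_ifs lam) (cantor_gfp lam).
  move=> x [S [S01 SS Sx]]; move: (SS _ Sx); apply: hutchS => y Sy.
  by exists S.
apply/seteqP; split=> // x Fx.
exists (hutch (cantor_ifs lam) (cantor_gfp lam)); split=> //.
  move=> y; rewrite hutch_cantorE => -[|] [u /cantor_gfp_sub01];
    rewrite /= in_itv/= => /andP[u0 u1] <-; rewrite in_itv/= /simap/=;
    apply/andP; split; nra.
exact: hutchS.
Qed.

(** The image of a compact set is closed, so the closure is again contained in its own image and in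
    [[0, 1]], hence in the greatest fixed point. *)
Lemma cantor_gfp_compact (R : realType) (lam : R) : 0 < lam < 2^-1 ->
  compact (@cantor_gfp R lam).
Proof.
move=> l01; have c01 : compact `[0 : R, 1] := @segment_compact R 0 1.
have cl01 : closure (cantor_gfp lam) `<=` `[0 : R, 1].
  have cl : closed `[0 : R, 1] by exact: interval_closed.
  by move=> x /(closureS (@cantor_gfp_sub01 R lam)) /cl.
have cc : compact (closure (@cantor_gfp R lam)).
  exact: subclosed_compact (@closed_closure _ _) c01 cl01.
suff -> : @cantor_gfp R lam = closure (cantor_gfp lam) by [].
apply/seteqP; split; first exact: subset_closure.
move=> x clx; exists (closure (cantor_gfp lam)); split=> // y cly.
have cH := compact_hutch_cantor (lam := lam) cc.
apply: (compact_closed (@norm_hausdorff _ R^o) cH); move: cly; apply: closureS.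
by rewrite {1}cantor_gfp_fix//; apply: hutchS; exact: subset_closure.
Qed.

(** Write [x] as an [n]-fold image of a point of [[0, 1]]; the same maps applied to a fixed [e] of
    [E] give a point of [E] within [(1 + |e|) * lam ^+ n] of [x]. *)
Lemma cantor_gfp_min (R : realType) (lam : R) (E : set R) : 0 < lam < 2^-1 ->
  is_attractor (cantor_ifs lam) E -> @cantor_gfp R lam `<=` E.
Proof.
move=> l01 [[e Ee] [cE EE]] x Fx; have /andP[l0 l1] := l01.
have lt1 : 0 < lam < 1 by rewrite l0/=; lra.
apply: (@compact_expr_approx R E lam (1 + `|e|) x lt1 cE) => n.
elim: n x Fx => [|n IH] x Fx.
  exists e => //; rewrite expr0 mulr1 (le_trans (ler_normB _ _))// lerD2r.
  by move/cantor_gfp_sub01: Fx; rewrite /= in_itv/= => /andP[x0 x1]; rewrite ger0_norm.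
have mk p u y : E y -> p \in cantor_ifs lam -> `|u - y| <= (1 + `|e|) * lam ^+ n ->
    simap p u = x -> p.1 = lam ->
    exists2 y, E y & `|x - y| <= (1 + `|e|) * lam ^+ n.+1.
  move=> Ey pin uy <- pE; exists (simap p y).
    by rewrite EE; exists p => //; exists y.
  rewrite /simap pE (_ : _ - _ = lam * (u - y)); last by ring.
  by rewrite normrM gtr0_norm// exprS mulrCA ler_pM2l.
move: Fx; rewrite cantor_gfp_fix// hutch_cantorE => -[|] [u Fu ux];
  have [y Ey uy] := IH _ Fu.
- by apply: (mk (lam, 0) u y) => //; rewrite inE eqxx.
- by apply: (mk (lam, 1 - lam) u y) => //; rewrite !inE eqxx orbT.
Qed.

Lemma cantor_gfp0 (R : realType) (lam : R) : 0 < lam < 2^-1 -> cantor_gfp lam 0.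
Proof.
move=> l01; exists [set 0]; split=> //.
  by move=> _ ->; rewrite /= in_itv/= lexx ler01.
by move=> _ ->; rewrite hutch_cantorE; left; exists 0 => //; rewrite /simap/=; ring.
Qed.

(** The greatest fixed point is itself an attractor and lies in every other one. *)
Lemma cantorFE (R : realType) (lam : R) : 0 < lam < 2^-1 ->
  cantorF lam = @cantor_gfp R lam.
Proof.
move=> l01; apply/seteqP; split=> x; last by move=> Fx E /(cantor_gfp_min l01); apply.
apply; split; first by exists 0; exact: cantor_gfp0.
by split; [exact: cantor_gfp_compact|exact: cantor_gfp_fix].
Qed.

Lemma cantorF01 (R : realType) (lam x : R) : 0 < lam < 2^-1 ->
  cantorF lam x -> 0 <= x <= 1.
Proof. by move=> l01; rewrite cantorFE// => /cantor_gfp_sub01; rewrite /= in_itv. Qed.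

Lemma cantorF_compact (R : realType) (lam : R) : 0 < lam < 2^-1 ->
  compact (@cantorF R lam).
Proof. by move=> l01; rewrite cantorFE//; exact: cantor_gfp_compact. Qed.

Lemma cantorFP (R : realType) (lam x : R) : 0 < lam < 2^-1 ->
  cantorF lam x <-> (exists2 y, cantorF lam y & x = lam * y) \/
                    (exists2 y, cantorF lam y & x = lam * y + (1 - lam)).
Proof.
move=> l01; rewrite cantorFE// {1}cantor_gfp_fix// hutch_cantorE.
split=> -[] [y Fy yx].
- by left; exists y => //; rewrite -yx /simap/= addr0.
- by right; exists y.
- by left; exists y => //; rewrite yx /simap/= addr0.
- by right; exists y.
Qed.

Lemma cantorFl (R : realType) (lam x : R) : 0 < lam < 2^-1 ->
  cantorF lam x -> cantorF lam (lam * x).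
Proof. by move=> l01 Fx; apply/cantorFP => //; left; exists x. Qed.

Lemma cantorFr (R : realType) (lam x : R) : 0 < lam < 2^-1 ->
  cantorF lam x -> cantorF lam (lam * x + (1 - lam)).
Proof. by move=> l01 Fx; apply/cantorFP => //; right; exists x. Qed.

Lemma cantorF_0 (R : realType) (lam : R) : 0 < lam < 2^-1 -> cantorF lam 0.
Proof. by move=> l01; rewrite cantorFE//; exact: cantor_gfp0. Qed.

Lemma cantorF_1 (R : realType) (lam : R) : 0 < lam < 2^-1 -> cantorF lam 1.
Proof.
move=> l01; rewrite cantorFE//; exists [set 1]; split=> //.
  by move=> _ ->; rewrite /= in_itv/= lexx ler01.
by move=> _ ->; rewrite hutch_cantorE; right; exists 1 => //; rewrite /simap/=; ring.
Qed.

(** * Gaps of the Cantor set and of its squares *)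

Definition misses (R : realType) (E : set R) (s t : R) : Prop :=
  forall x, s < x < t -> ~ E x.

Lemma missesP (R : realType) (E : set R) (s t x : R) :
  misses E s t -> E x -> x <= s \/ t <= x.
Proof.
move=> mst Ex; have [xs|sx] := leP x s; first by left.
by have [tx|xt] := leP t x; [right|case: (mst x) => //; rewrite sx].
Qed.

Lemma cantorF_lam (R : realType) (lam : R) : 0 < lam < 2^-1 -> cantorF lam lam.
Proof. by move=> l01; have := cantorFl l01 (cantorF_1 l01); rewrite mulr1. Qed.

Lemma cantorF_1lam (R : realType) (lam : R) : 0 < lam < 2^-1 -> cantorF lam (1 - lam).
Proof. by move=> l01; have := cantorFr l01 (cantorF_0 l01); rewrite mulr0 add0r. Qed.

(** Both [lam] and [1 - lam] belong to the Cantor set, so the interval lies in the central gap or in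
    one of the two cylinders; a cylinder is rescaled to [[0, 1]]. *)
Lemma misses_cantorF_cases (R : realType) (lam s t : R) : 0 < lam < 2^-1 ->
    0 <= s -> s < t -> t <= 1 -> misses (cantorF lam) s t ->
  (lam <= s /\ t <= 1 - lam) \/
  exists s' t', [/\ 0 <= s', s' < t', t' <= 1, misses (cantorF lam) s' t' &
                    t - s = lam * (t' - s')].
Proof.
move=> l01 s0 st t1 mst; have /andP[l0 l1] := l01.
case: (missesP mst (cantorF_lam l01)) => [ls|tl]; last first.
  right; exists (s / lam), (t / lam); split.
  - by rewrite divr_ge0// ltW.
  - by rewrite ltr_pM2r ?invr_gt0.
  - by rewrite ler_pdivrMr// mul1r.
  - move=> x; rewrite ltr_pdivrMr// ltr_pdivlMr// => sxt /(cantorFl l01).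
    by apply: mst; rewrite mulrC.
  - by field; rewrite gt_eqF.
case: (missesP mst (cantorF_1lam l01)) => [ls'|tl]; last by left.
right; exists ((s - (1 - lam)) / lam), ((t - (1 - lam)) / lam); split.
- by rewrite divr_ge0 ?(ltW l0)//; lra.
- by rewrite ltr_pM2r ?invr_gt0// ltrD2r.
- by rewrite ler_pdivrMr// mul1r; lra.
- move=> x; rewrite ltr_pdivrMr// ltr_pdivlMr// => sxt /(cantorFr l01).
  by apply: mst; rewrite mulrC; lra.
- by field; rewrite gt_eqF.
Qed.

Lemma misses_cantorF_le (R : realType) (lam s t : R) : 0 < lam < 2^-1 ->
  0 <= s -> s < t -> t <= 1 -> misses (cantorF lam) s t -> t - s <= 1 - 2 * lam.
Proof.
move=> l01 s0 st t1 mst; have /andP[l0 l1] := l01.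
have lt1 : 0 < lam < 1 by rewrite l0/=; lra.
(* Each rescaling that avoids the central gap contributes one factor [lam]. *)
have aux n : forall s t, 0 <= s -> s < t -> t <= 1 -> misses (cantorF lam) s t ->
    t - s <= 1 - 2 * lam \/ t - s <= lam ^+ n.
  elim: n => [|n IH] {s0 st t1 mst}s {}t s0 st t1 mst; first by right; rewrite expr0; lra.
  case: (misses_cantorF_cases l01 s0 st t1 mst) => [[ls tl]|]; first by left; lra.
  move=> [s' [t' [s0' st' t1' mst' E]]]; have [i|i] := IH _ _ s0' st' t1' mst'.
    by left; rewrite E; nra.
  by right; rewrite E exprS ler_pM2l.
rewrite leNgt; apply/negP => gt.
have ts0 : 0 < t - s by lra.
have [n ln] := expr_lt_eps lt1 ts0.
have [] := aux n _ _ s0 st t1 mst; lra.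
Qed.

(** Let [p], [q] be the square roots of the ends. Inside the central gap, [q ^ 2 - p ^ 2] is at most
    [(1 - lam) ^ 2 - lam ^ 2 = 1 - 2 * lam], with equality only at the ends. Elsewhere
    [q - p <= lam * (1 - 2 * lam)] and [q + p <= 2], which is too short because [2 * lam < 1]. *)
Lemma misses_cantorF2_max (R : realType) (lam s t : R) : 0 < lam < 2^-1 ->
    0 <= s -> s < t -> t <= 1 -> misses (cantorF2 lam) s t ->
    1 - 2 * lam <= t - s ->
  s = lam ^+ 2 /\ t = (1 - lam) ^+ 2.
Proof.
move=> l01 s0 st t1 mst; have /andP[l0 l1] := l01.
have t0 : 0 <= t by lra.
have qs0 : 0 <= Num.sqrt s by exact: sqrtr_ge0.
have qt0 : 0 <= Num.sqrt t by exact: sqrtr_ge0.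
have sE := sqr_sqrtr s0; have tE := sqr_sqrtr t0.
move: (Num.sqrt s) (Num.sqrt t) qs0 qt0 sE tE => p q p0 q0 sE tE.
have pq : p < q by nra.
have q1 : q <= 1 by nra.
have mpq : misses (cantorF lam) p q.
  move=> x /andP[px xq] Fx; apply: (mst (x ^+ 2)); last by exists x.
  by apply/andP; split; nra.
case: (misses_cantorF_cases l01 p0 pq q1 mpq) => [[lp ql]|].
  move=> len.
  have : lam ^+ 2 <= s by nra.
  have : t <= (1 - lam) ^+ 2 by nra.
  by split; nra.
move=> [p' [q' [p0' pq' q1' mpq' E]]] len.
have le' := misses_cantorF_le l01 p0' pq' q1' mpq'.
have le2 : q - p <= lam * (1 - 2 * lam) by rewrite E ler_pM2l.
have l2 : 0 < lam * (1 - 2 * lam) by rewrite mulr_gt0//; lra.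
exfalso; have : t - s = (q - p) * (q + p) by rewrite -sE -tE; ring.
have : (q - p) * (q + p) <= (q - p) * 2 by rewrite ler_pM2l; lra.
have : 0 < (1 - 2 * lam) * (1 - 2 * lam) by rewrite mulr_gt0; lra.
lra.
Qed.

(** This interval is the image of the central gap under [n] applications of the right-hand map. *)
Lemma misses_cantorF_near1 (R : realType) (lam : R) (n : nat) : 0 < lam < 2^-1 ->
  misses (cantorF lam) (1 - lam ^+ n * (1 - lam)) (1 - lam ^+ n.+1).
Proof.
move=> l01; have /andP[l0 l1] := l01.
elim: n => [|n IH] x /andP[xl xr] Fx;
  have [[y Fy xE]|[y Fy xE]] := (cantorFP x l01).1 Fx;
  have /andP[y0 y1] := cantorF01 l01 Fy.
- by move: xl; rewrite expr0 xE; nra.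
- by move: xr; rewrite expr1 xE; nra.
- have : lam ^+ n.+1 <= lam.
    by rewrite exprS ler_piMr ?exprn_ile1 ?(ltW l0)//; lra.
  by move: xl; rewrite xE; nra.
- apply: (IH y) => //; apply/andP.
  rewrite exprS in xl; rewrite exprS in xr.
  by split; rewrite -(ltr_pM2l l0); lra.
Qed.

Lemma misses_cantorF2_near1 (R : realType) (lam : R) (n : nat) : 0 < lam < 2^-1 ->
  misses (cantorF2 lam) ((1 - lam ^+ n * (1 - lam)) ^+ 2) ((1 - lam ^+ n.+1) ^+ 2).
Proof.
move=> l01; have /andP[l0 l1] := l01.
have h1 m : lam ^+ m <= 1 by rewrite exprn_ile1 ?(ltW l0)//; lra.
have h0 : 0 < lam ^+ n by rewrite exprn_gt0.
move=> z /andP[yl yr] [x Fx xy]; move: yl yr; rewrite -xy.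
have /andP[x0 x1] := cantorF01 l01 Fx.
rewrite !ltr_pXn2r ?nnegrE ?subr_ge0// => [xl xr|]; last by have := h1 n; nra.
by apply: (misses_cantorF_near1 (n := n) l01) Fx; rewrite xl.
Qed.

(** * Similarities mapping the squares into themselves *)

Lemma misses_simap (R : realType) (E : set R) (p : R * R) (s t : R) :
    (forall x, E x -> E (simap p x)) ->
    misses E (Num.min (simap p s) (simap p t)) (Num.max (simap p s) (simap p t)) ->
    p.1 != 0 ->
  misses E s t.
Proof.
move=> Ep mE p0 x /andP[sx xt] Ex; apply: (mE (simap p x)); last exact: Ep.
rewrite gt_min lt_max /simap !ltrD2r.
move: p0; rewrite neq_lt => /orP[p0|p0].
  by rewrite !(ltr_nM2l p0) sx xt !orbT.
by rewrite !(ltr_pM2l p0) sx xt orbT.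
Qed.

(* The gap [(A, B)] is the central gap of the squared cylinder [[(1 - h) ^ 2, 1]];
   squaring keeps its relative length [1 - 2 * lam]. *)
Lemma cantorF2_no_map_onto1 (R : realType) (lam : R) (p : R * R) (y : R) :
    0 < lam < 2^-1 -> 0 < `|p.1| < 1 ->
    (forall x, cantorF2 lam x -> cantorF2 lam (simap p x)) ->
    cantorF2 lam y -> simap p y <> 1.
Proof.
case: p => r b /= l01 /andP[r0 r1] Ep Ey py1; have /andP[l0 l1] := l01.
have E01 z : cantorF2 lam z -> 0 <= z <= 1.
  by move=> [x /(cantorF01 l01)/andP[x0 x1] <-]; apply/andP; split; nra.
have E0 : cantorF2 lam 0 by exists 0; [exact: cantorF_0|rewrite expr0n].
have E1 : cantorF2 lam 1 by exists 1; [exact: cantorF_1|rewrite expr1n].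
have /andP[y0 y1] := E01 _ Ey.
have f0 : cantorF2 lam b by have := Ep _ E0; rewrite /simap/= mulr0 add0r.
have f1 : cantorF2 lam (r + b) by have := Ep _ E1; rewrite /simap/= mulr1.
have /andP[b0 b1] := E01 _ f0; have /andP[rb0 rb1] := E01 _ f1.
rewrite /simap/= in py1.
have lt1 : 0 < lam < 1 by rewrite l0/=; lra.
(* Since 1 is the maximum of the squares, a value 1 can only be taken at an end of the hull; the
   other end then goes to [1 - |r|]. *)
have ends : (0 < r /\ b = 1 - `|r|) \/ (r < 0 /\ b = 1).
  have : r != 0 by rewrite -normr_gt0.
  rewrite neq_lt => /orP[rn|rp]; [right|left]; split=> //.
    by nra.
  by rewrite gtr0_norm//; nra.
have Ew : cantorF2 lam (1 - `|r|).
  case: ends => [[rp bE]|[rn bE]]; first by rewrite -bE.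
  by rewrite ltr0_norm// opprK addrC -bE.
move: Ew => [x Fx xE]; have /andP[x0 x1] := cantorF01 l01 Fx.
have xlt : 0 < 1 - x by nra.
have ex : exists n, lam ^+ n < 1 - x by exact: expr_lt_eps.
(* The least exponent is positive; its predecessor [n] gives [h = lam ^+ n] with
   [1 - h <= x < 1 - lam * h]. Since [x] avoids the central gap of [[1 - h, 1]], it lies to the left
   of that gap. *)
case: (ex_minnP ex) => -[|n] ln minn; first by move: ln; rewrite expr0; lra.
have xh : 1 - lam ^+ n <= x.
  by rewrite lerBlDr -lerBlDl leNgt; apply/negP => /minn; rewrite ltnn.
have mst := misses_cantorF2_near1 (n := n) l01.
have xA : x <= 1 - lam ^+ n * (1 - lam).
  case: (missesP (misses_cantorF_near1 (n := n) l01) Fx) => //; lra.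
have h0 : 0 < lam ^+ n by rewrite exprn_gt0.
have h1 : lam ^+ n <= 1 by rewrite exprn_ile1 ?(ltW l0)//; lra.
rewrite (exprS lam n) in mst ln; move: (lam ^+ n) mst ln xh xA h0 h1 => h mst ln xh xA h0 h1.
have lh : lam * h <= h by rewrite ler_piMl; lra.
have lh0 : 0 < lam * h by rewrite mulr_gt0.
set A := (1 - h * (1 - lam)) ^+ 2 in mst; set B := (1 - lam * h) ^+ 2 in mst.
have BA : B - A = (1 - 2 * lam) * (1 - (1 - h) ^+ 2) by rewrite /A /B; ring.
have rS : `|r| <= 1 - (1 - h) ^+ 2 by nra.
have Ar : 1 - `|r| <= A by rewrite -xE /A; nra.
have B1 : B <= 1 by rewrite /B; nra.
have AB : A < B by rewrite -subr_gt0 BA mulr_gt0//; lra.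
have rn0 : r != 0 by rewrite -normr_gt0.
have fK z : simap (r, b) ((z - b) / r) = z by rewrite /simap/=; field.
(* The image hull is no longer than the squared cylinder, so the pulled-back gap has at least the
   maximal length and must be the longest gap. *)
have lenr : 1 - 2 * lam <= (B - A) / `|r|.
  by rewrite ler_pdivlMr// BA ler_pM2l//; lra.
case: ends => [[rp bE]|[rn bE]].
- rewrite gtr0_norm// in r0 r1 xE rS Ar bE lenr.
  have m' : misses (cantorF2 lam) ((A - b) / r) ((B - b) / r).
    by apply: (misses_simap Ep) => //; rewrite !fK min_l ?max_r ?(ltW AB).
  have [||||sE tE] := misses_cantorF2_max l01 _ _ _ m'.
  + by rewrite divr_ge0 ?(ltW rp)//; lra.
  + by rewrite ltr_pM2r ?invr_gt0//; lra.
  + by rewrite ler_pdivrMr//; lra.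
  + by rewrite -mulrBl opprB addrA subrK.
  have AE : A = r * lam ^+ 2 + b by rewrite -sE; field.
  have BE : B = r * (1 - lam) ^+ 2 + b by rewrite -tE; field.
  have rE : r = 1 - (1 - h) ^+ 2.
    have : (1 - 2 * lam) * (r - (1 - (1 - h) ^+ 2)) = 0.
      by rewrite mulrBr -BA AE BE; ring.
    by move/eqP; rewrite mulf_eq0 => /orP[/eqP|/eqP]; lra.
  (* The contraction condition [r < 1] excludes [h = 1]; the two expressions for [A] then differ by
     the positive quantity below. *)
  have hlt : h < 1 by nra.
  have : 2 * lam * h * (1 - lam) * (1 - h) = 0.
    have : A = r * lam ^+ 2 + (1 - r) by rewrite AE bE.
    by rewrite rE /A; lra.
  by apply/eqP; rewrite gt_eqF// !mulr_gt0//; lra.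
- rewrite ltr0_norm// in r0 r1 xE rS Ar lenr.
  have m' : misses (cantorF2 lam) ((B - b) / r) ((A - b) / r).
    by apply: (misses_simap Ep) => //; rewrite !fK min_r ?max_l ?(ltW AB).
  have [||||sE tE] := misses_cantorF2_max l01 _ _ _ m'.
  + by rewrite -divrNN divr_ge0 ?(ltW r0)//; lra.
  + by rewrite ltr_nM2r ?invr_lt0//; lra.
  + by rewrite ler_ndivrMr//; lra.
  + by rewrite -mulrBl -divrNN; apply: le_trans lenr _; rewrite ler_pM2r ?invr_gt0//; lra.
  have AE : A = r * (1 - lam) ^+ 2 + 1 by rewrite -tE bE; field.
  have BE : B = r * lam ^+ 2 + 1 by rewrite -sE bE; field.
  have rE : r = - (1 - (1 - h) ^+ 2).
    have : (1 - 2 * lam) * (r + (1 - (1 - h) ^+ 2)) = 0.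
      by rewrite mulrDr -BA AE BE; ring.
    by move/eqP; rewrite mulf_eq0 => /orP[/eqP|/eqP]; lra.
  (* With reversed orientation the two expressions for [A] differ by this quantity, positive for
     every [h > 0]. *)
  have : 2 * lam * h * (1 - lam) = 0.
    by move: AE; rewrite rE /A; lra.
  by apply/eqP; rewrite gt_eqF// !mulr_gt0//; lra.
Qed.

Lemma cantorF2_not_self_similar (R : realType) (lam : R) : 0 < lam < 2^-1 ->
  ~ self_similar (cantorF2 lam).
Proof.
move=> l01 [fs [_ [ctr [_ [_ EE]]]]].
have E1 : cantorF2 lam 1 by exists 1; [exact: cantorF_1|rewrite expr1n].
have [p pfs [y Ey /esym y1]] : hutch fs (cantorF2 lam) 1 by rewrite -EE.
apply: (cantorF2_no_map_onto1 l01 (ctr _ pfs)) Ey y1 => x Ex.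
by rewrite EE; exists p => //; exists x.
Qed.

(** * Images of products of cylinders under [x ^ 2 / y] *)

(* On a square of side [h] at [(a, b)] the images of the four corner squares
   of side [lam * h] under [x ^ 2 / y], ordered by their lower ends, overlap. *)
Definition corners_overlap (R : realType) (lam a b h : R) : Prop :=
  [/\ a ^+ 2 * (b + h - lam * h) <= (a + lam * h) ^+ 2 * (b + lam * h),
      (a + h - lam * h) ^+ 2 * b <= (a + lam * h) ^+ 2 * (b + h) &
      (a + h - lam * h) ^+ 2 * (b + h - lam * h) <= (a + h) ^+ 2 * (b + lam * h)].

(** For [x > 0] this reads [q / x <= p / y < z]: a value beyond the upper end of one corner image is
    beyond the lower end of the next. *)
Lemma overlap_step (R : realType) (p q x y z : R) :
  0 < y -> 0 <= x -> p < z * y -> q * y <= p * x -> q <= z * x.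
Proof.
move=> y0 x0 pz qp; rewrite -(ler_pM2r y0) (le_trans qp)//.
by rewrite mulrAC ler_wpM2r// ltW.
Qed.

(** The last two bounds place [z] in the image interval of the square. Overlap passes this to a
    corner square, so the descent can be repeated; [u] and [v] are coordinates relative to the
    square. *)
Lemma quotient_approx (R : realType) (lam e z : R) (n : nat) : 0 < lam < 2^-1 ->
    e < 1 -> 0 <= z ->
    (forall a b h, 0 < h -> 1 - e <= a -> a + h <= 1 -> 1 - e <= b -> b + h <= 1 ->
       corners_overlap lam a b h) ->
  forall a b h, 0 < h -> 1 - e <= a -> a + h <= 1 -> 1 - e <= b -> b + h <= 1 ->
    a ^+ 2 <= z * (b + h) -> z * b <= (a + h) ^+ 2 ->
  exists u v, [/\ cantorF lam u, cantorF lam v &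
    `|z * (b + h * v) - (a + h * u) ^+ 2| <= (2 + z) * h * lam ^+ n].
Proof.
move=> l01 e1 z0 ov; have /andP[l0 l1] := l01.
elim: n => [|n IH] a b h h0 ae ah be bh lo hi.
  exists 0, 0; split; [exact: cantorF_0|exact: cantorF_0|].
  rewrite !mulr0 !addr0 expr0 mulr1 ler_norml; apply/andP; split; nra.
have [ov1 ov2 ov3] := ov _ _ _ h0 ae ah be bh.
have lh0 : 0 < lam * h by rewrite mulr_gt0.
have lh1 : lam * h < h by nra.
have b0 : 0 < b by lra.
have y0 : 0 < b + h - lam * h by lra.
have x0 : 0 <= b + lam * h by lra.
have bnd (s t : R) : (s = 0 \/ s = 1 - lam) -> (t = 0 \/ t = 1 - lam) ->
    (a + h * s) ^+ 2 <= z * (b + h * t + lam * h) ->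
    z * (b + h * t) <= (a + h * s + lam * h) ^+ 2 ->
    exists u v, [/\ cantorF lam u, cantorF lam v &
      `|z * (b + h * v) - (a + h * u) ^+ 2| <= (2 + z) * h * lam ^+ n.+1].
  move=> sE tE lo' hi'.
  have [||||u [v [Fu Fv uv]]] := IH _ _ _ lh0 _ _ _ _ lo' hi'.
  - by case: sE => ->; nra.
  - by case: sE => ->; nra.
  - by case: tE => ->; nra.
  - by case: tE => ->; nra.
  exists (lam * u + s), (lam * v + t); split.
  - by case: sE => ->; [rewrite addr0; exact: cantorFl|exact: cantorFr].
  - by case: tE => ->; [rewrite addr0; exact: cantorFl|exact: cantorFr].
  - move: uv; rewrite (exprS lam n).
    have -> : b + h * t + lam * h * v = b + h * (lam * v + t) by ring.
    have -> : a + h * s + lam * h * u = a + h * (lam * u + s) by ring.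
    by have -> : (2 + z) * (lam * h) * lam ^+ n = (2 + z) * h * (lam * lam ^+ n) by ring.
have E1 c : c + h * 0 = c by ring.
have E2 c : c + h * (1 - lam) = c + h - lam * h by ring.
have E3 c : c + h - lam * h + lam * h = c + h by ring.
(* The corners are tried by increasing lower ends. Failing the upper bound of one yields the lower
   bound of the next; [lo] starts the chain and [hi] closes it. *)
have [c1|c1] := leP (z * (b + h - lam * h)) ((a + lam * h) ^+ 2).
  by apply: (bnd 0 (1 - lam)); rewrite ?E1 ?E2 ?E3; auto.
have lo1 : a ^+ 2 <= z * (b + lam * h) := overlap_step y0 x0 c1 ov1.
have [c2|c2] := leP (z * b) ((a + lam * h) ^+ 2).
  by apply: (bnd 0 0); rewrite ?E1 ?E2 ?E3; auto.
have lo2 : (a + h - lam * h) ^+ 2 <= z * (b + h).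
  by apply: overlap_step b0 _ c2 ov2; lra.
have [c3|c3] := leP (z * (b + h - lam * h)) ((a + h) ^+ 2).
  by apply: (bnd (1 - lam) (1 - lam)); rewrite ?E1 ?E2 ?E3; auto.
have lo3 : (a + h - lam * h) ^+ 2 <= z * (b + lam * h) := overlap_step y0 x0 c3 ov3.
by apply: (bnd (1 - lam) 0); rewrite ?E1 ?E2 ?E3; auto.
Qed.

(** The approximate solutions show that 0 is a limit of values of [f] on a compact product, hence a
    value. *)
Lemma quotient_onto (R : realType) (lam a h z : R) : 0 < lam < 2^-1 ->
    0 < h -> 0 < a -> a + h = 1 ->
    (forall a' b' h', 0 < h' -> a <= a' -> a' + h' <= 1 -> a <= b' -> b' + h' <= 1 ->
       corners_overlap lam a' b' h') ->
    a ^+ 2 <= z -> z * a <= 1 ->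
  exists u v, [/\ cantorF lam u, cantorF lam v & z * (a + h * v) = (a + h * u) ^+ 2].
Proof.
move=> l01 h0 a0 ah ov lo hi; have /andP[l0 l1] := l01.
have aE : a = 1 - h by lra.
have z0 : 0 <= z by rewrite (le_trans _ lo)// sqr_ge0.
pose f (p : R * R) : R := z * (a + h * p.2) - (a + h * p.1) ^+ 2.
have cf : continuous f.
  move=> p; apply: cvgB.
    apply: cvgM; first exact: cvg_cst.
    apply: cvgD; first exact: cvg_cst.
    by apply: cvgM; [exact: cvg_cst|exact: cvg_snd].
  by rewrite /= !expr2; apply: cvgM; (apply: cvgD; first exact: cvg_cst);
    (apply: cvgM; [exact: cvg_cst|exact: cvg_fst]).
have cA : compact (f @` (cantorF lam `*` cantorF lam)).
  apply: continuous_compact; first exact: continuous_subspaceT.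
  by apply: compact_setX; exact: cantorF_compact.
have lt1 : 0 < lam < 1 by rewrite l0/=; lra.
have [[u v] [/= Fu Fv] fuv] : (f @` (cantorF lam `*` cantorF lam)) 0.
  apply: (@compact_expr_approx _ _ lam ((2 + z) * h) _ lt1 cA) => n.
  have h1 : h < 1 by lra.
  have := @quotient_approx R lam h z n l01 h1 z0.
  rewrite -aE => /(_ ov a a h h0 (lexx _)); rewrite ah mulr1 expr1n.
  move=> /(_ (lexx _) (lexx _) (lexx _) lo hi)[u [v [Fu Fv uv]]].
  by exists (f (u, v)); [exists (u, v)|rewrite sub0r normrN].
exists u, v; split=> //; move: fuv; rewrite /f/=; lra.
Qed.

(** * Slopes realised by cylinders next to 1 *)

Lemma cantorF_near1 (R : realType) (lam u : R) (n : nat) : 0 < lam < 2^-1 ->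
  cantorF lam u -> cantorF lam (1 - lam ^+ n + lam ^+ n * u).
Proof.
move=> l01 Fu; elim: n => [|n IH].
  by rewrite (_ : _ + _ = u) ?expr0//; ring.
rewrite (_ : _ + _ = lam * (1 - lam ^+ n + lam ^+ n * u) + (1 - lam)); first exact: cantorFr.
by rewrite exprS; ring.
Qed.

(** The condition [0 < n] keeps the left end of the cylinder, and so the denominators, positive. *)
Lemma setD_lam_near1 (R : realType) (lam z : R) (n : nat) : 0 < lam < 2^-1 ->
    (0 < n)%N ->
    (forall a b h, 0 < h -> 1 - lam ^+ n <= a -> a + h <= 1 ->
       1 - lam ^+ n <= b -> b + h <= 1 -> corners_overlap lam a b h) ->
    (1 - lam ^+ n) ^+ 2 <= z -> z * (1 - lam ^+ n) <= 1 ->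
  setD_lam lam z.
Proof.
move=> l01 n0 ov lo hi; have /andP[l0 l1] := l01.
have h0 : 0 < lam ^+ n by rewrite exprn_gt0.
have h1 : lam ^+ n < 1 by rewrite exprn_ilt1 ?ltW ?gt_eqF//; lra.
have [||u [v [Fu Fv uv]]] := @quotient_onto R lam (1 - lam ^+ n) (lam ^+ n) z l01 h0 _ _ ov lo hi.
- by lra.
- by ring.
have /andP[v0 _] := cantorF01 l01 Fv.
have d0 : 1 - lam ^+ n + lam ^+ n * v != 0 by rewrite gt_eqF//; nra.
exists (1 - lam ^+ n + lam ^+ n * u), (1 - lam ^+ n + lam ^+ n * v); split=> //.
- exact: cantorF_near1.
- exact: cantorF_near1.
- by rewrite -uv mulfK.
Qed.

(** Each overlap difference is [h] times an expression weighing the gap ratio [1 - 2 * lam] against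
    the coordinates, which [m] bounds from below. *)
Lemma corners_overlap_above (R : realType) (lam m a b h : R) : 0 < lam < 2^-1 ->
    4^-1 <= m -> 2 * (1 - 2 * lam) <= m -> 1 - 2 * lam <= 13 / 8 * lam * m ->
    0 < h -> m <= a -> a + h <= 1 -> m <= b -> b + h <= 1 ->
  corners_overlap lam a b h.
Proof.
move=> /andP[l0 l1] m4 m1 m2 h0 ma a1 mb b1; have m0 : 0 < m by lra.
have l2 : 0 < 1 - 2 * lam by lra.
have lb : lam * m <= lam * b by rewrite ler_pM2l.
have la : lam * m <= lam * a by rewrite ler_pM2l.
have lm0 : 0 < lam * m by rewrite mulr_gt0.
have lh0 : 0 < lam * h by rewrite mulr_gt0.
have a0 : 0 < a by lra.
split; rewrite -subr_ge0.
- rewrite (_ : _ - _ = h * (a * (2 * (lam * b) - a * (1 - 2 * lam))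
      + (2 * a * lam + lam * (lam * h)) * (lam * h) + lam * (lam * h) * b)); last by ring.
  have p1 : a * (1 - 2 * lam) <= 1 - 2 * lam by rewrite ler_piMl; lra.
  have p2 : 0 <= a * (2 * (lam * b) - a * (1 - 2 * lam)) by rewrite mulr_ge0; lra.
  have p3 : 0 <= lam * (lam * h) by rewrite mulr_ge0; lra.
  have p4 : 0 <= (2 * a * lam + lam * (lam * h)) * (lam * h) by rewrite mulr_ge0; nra.
  have p5 : 0 <= lam * (lam * h) * b by rewrite mulr_ge0; lra.
  by rewrite mulr_ge0; lra.
- rewrite (_ : _ - _ = h * ((a + lam * h) ^+ 2 - b * ((1 - 2 * lam) * (2 * a + h)))); last by ring.
  rewrite mulr_ge0 ?(ltW h0)// subr_ge0.
  apply: (@le_trans _ _ ((1 - 2 * lam) * (2 * a + h))).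
    by rewrite ler_piMl ?mulr_ge0//; lra.
  have p1 : a * (2 * (1 - 2 * lam)) <= a * a by rewrite ler_pM2l; lra.
  have p2 : h * (1 - 2 * lam) <= h * (2 * (lam * a)) by rewrite ler_pM2l//; lra.
  have p3 : 0 <= (lam * h) ^+ 2 by exact: sqr_ge0.
  lra.
- rewrite (_ : _ - _ = h * (lam * (2 * (a + h) - lam * h) * (b + (1 - lam) * h)
      - (a + h) * ((a + h) * (1 - 2 * lam)))); last by ring.
  rewrite mulr_ge0 ?(ltW h0)// subr_ge0.
  (* From [4^-1 <= m] follows [h <= 3 * a], whence this bound; [13 / 8] is [2 - 3 / 8]. *)
  have p1 : 8 * (lam * h) <= 3 * (a + h).
    have : lam * h <= 2^-1 * h by rewrite ler_pM2r//; lra.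
    lra.
  have p3 : (a + h) * (13 / 8) <= 2 * (a + h) - lam * h by lra.
  apply: (@le_trans _ _ (lam * ((a + h) * (13 / 8)) * b)).
    rewrite (_ : lam * _ * b = (a + h) * (13 / 8 * (lam * b))); last by ring.
    rewrite ler_pM2l; last by lra.
    have : (a + h) * (1 - 2 * lam) <= 1 - 2 * lam by rewrite ler_piMl; lra.
    lra.
  apply: ler_pM; rewrite ?mulr_ge0 ?ler_wpM2l//; try lra.
  have : 0 <= (1 - lam) * h by rewrite mulr_ge0; lra.
  lra.
Qed.

(** With [m = 1 - lam], the condition [2 * (1 - 2 * lam) <= m] is exactly [3^-1 <= lam]. *)
Lemma corners_overlap_third (R : realType) (lam a b h : R) : 3^-1 <= lam < 2^-1 ->
  0 < h -> 1 - lam <= a -> a + h <= 1 -> 1 - lam <= b -> b + h <= 1 ->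
  corners_overlap lam a b h.
Proof.
move=> /andP[l0 l1]; apply: corners_overlap_above; try lra.
(* The concave [lam * (1 - lam)] lies above its chord on [[3^-1, 2^-1]], which makes the goal
   linear. *)
by have : 0 <= (lam - 3^-1) * (2^-1 - lam); [rewrite mulr_ge0; lra|lra].
Qed.

(** * Scaling by powers of [lam], and intervals of slopes *)

Lemma setD_lam_scale (R : realType) (lam z : R) (m n : nat) : 0 < lam < 2^-1 ->
  setD_lam lam z -> setD_lam lam (z * lam ^+ m / lam ^+ n).
Proof.
move=> l01; have /andP[l0 _] := l01; have l' : lam != 0 by rewrite gt_eqF.
(* Scaling both coordinates by [lam] multiplies the quotient by [lam]; scaling the denominator alone
   divides it. *)
move=> Dz; have : setD_lam lam (z * lam ^+ m).
  elim: m => [|m [x [y [Fx Fy y0 E]]]]; first by rewrite mulr1.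
  exists (lam * x), (lam * y); split; rewrite ?mulf_neq0//; try exact: cantorFl.
  by rewrite exprSr mulrA E; field; rewrite y0.
elim: n => [|n IH]; first by rewrite divr1.
move=> /IH [x [y [Fx Fy y0 E]]].
exists x, (lam * y); split; rewrite ?mulf_neq0//; try exact: cantorFl.
by rewrite exprS invfM mulrCA E; field; rewrite y0.
Qed.

Lemma scale_into (R : realType) (q k : R) : 0 < q < 1 -> 0 < k ->
  exists m n : nat, q < k * q ^+ m / q ^+ n <= 1.
Proof.
move=> q01 k0; have /andP[q0 q1] := q01.
have [m km] : exists m, k * q ^+ m <= 1.
  have [m qm] := expr_lt_eps q01 (divr_gt0 ltr01 k0); exists m.
  by rewrite mulrC -ler_pdivlMr// ltW.
have x0 : 0 < k * q ^+ m by rewrite mulr_gt0 ?exprn_gt0.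
have ex : exists n, q ^+ n < k * q ^+ m by exact: expr_lt_eps.
exists m; case: (ex_minnP ex) => -[|n] qn minn; first by move: qn; rewrite expr0 ltNge km.
exists n; have qn0 : 0 < q ^+ n by rewrite exprn_gt0.
rewrite ltr_pdivlMr// ler_pdivrMr// mul1r -exprS qn/=.
by rewrite leNgt; apply/negP => /minn; rewrite ltnn.
Qed.

Lemma setD_lam_ge0 (R : realType) (lam k : R) : 3^-1 <= lam < 2^-1 -> 0 <= k ->
  setD_lam lam k.
Proof.
move=> l3; have /andP[l31 l1] := l3.
have l01 : 0 < lam < 2^-1 by rewrite l1 andbT; lra.
have l0 : 0 < lam by lra.
rewrite le_eqVlt => /predU1P[<-|k0].
  exists 0, 1; split; [exact: cantorF_0|exact: cantorF_1|exact: oner_neq0|].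
  by rewrite expr0n/= mul0r.
have lt1 : 0 < lam < 1 by rewrite l0/=; lra.
have [m [n]] := scale_into lt1 k0.
set w := _ / _ => /andP[w1 w2].
have kE : k = w * lam ^+ n / lam ^+ m.
  by rewrite /w mulfVK ?mulfK ?expf_neq0 ?gt_eqF.
rewrite kE; apply: setD_lam_scale => //.
have near z : (1 - lam) ^+ 2 <= z -> z * (1 - lam) <= 1 -> setD_lam lam z.
  by move=> zl zh; apply: (@setD_lam_near1 _ _ _ 1) => // *; exact: corners_overlap_third.
have [wl|wl] := leP ((1 - lam) ^+ 2) w.
  by apply: near => //; nra.
(* [(1 - lam) ^ 3 <= lam] makes the fundamental domain [[lam, 1]] fit in the
   union of [[(1 - lam) ^ 2, (1 - lam)^-1]] and its image under [lam]. *)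
rewrite (_ : w = w / lam * lam ^+ 1 / lam ^+ 0); last first.
  by rewrite expr0 expr1 divr1 mulfVK ?gt_eqF.
apply: setD_lam_scale => //; apply: near.
  by rewrite ler_pdivlMr//; nra.
rewrite mulrAC ler_pdivrMr// mul1r.
have : (1 - lam) ^+ 3 <= lam by nra.
rewrite exprS => c3; apply: le_trans c3.
by rewrite mulrC ler_wpM2l ?(ltW wl)//; lra.
Qed.

(** Here [lam < 3^-1] gives [lam ^+ 4 <= 81^-1], so the level-four cylinder at 1 allows
    [m = 80 / 81]. *)
Lemma corners_overlap_near1 (R : realType) (lam a b h : R) : 29 / 100 <= lam < 3^-1 ->
  0 < h -> 1 - lam ^+ 4 <= a -> a + h <= 1 -> 1 - lam ^+ 4 <= b -> b + h <= 1 ->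
  corners_overlap lam a b h.
Proof.
move=> /andP[l0 l1] h0.
have l2 : lam ^+ 2 <= 9^-1 by nra.
have : lam ^+ 4 <= 81^-1.
  have -> : lam ^+ 4 = (lam ^+ 2) ^+ 2 by rewrite -exprM.
  have := sqr_ge0 lam.
  by move: (lam ^+ 2) l2 => q q1 q0; nra.
move: (lam ^+ 4) => e e1 a0 a1 b0 b1.
by apply: (@corners_overlap_above _ _ (80 / 81)) => //; try lra;
  apply/andP; split; lra.
Qed.

Lemma setD_lam_interval (R : realType) (lam : R) : 29 / 100 <= lam < 2^-1 ->
  exists a b : R, a < b /\ `[a, b] `<=` setD_lam lam.
Proof.
move=> /andP[l29 l1]; have l0 : 0 < lam by lra.
have [l3|l3] := leP 3^-1 lam.
  exists 0, 1; split=> [|z]; first exact: ltr01.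
  by rewrite /= in_itv/= => /andP[z0 _]; apply: setD_lam_ge0; rewrite ?l3.
have l01 : 0 < lam < 2^-1 by rewrite l0.
have h0 : 0 < lam ^+ 4 by rewrite exprn_gt0.
have h1 : lam ^+ 4 < 1 by rewrite exprn_ilt1 ?ltW//; lra.
exists ((1 - lam ^+ 4) ^+ 2), 1; split; first by nra.
move=> z; rewrite /= in_itv/= => /andP[zl zh].
apply: (@setD_lam_near1 _ _ _ 4) => //; last by nra.
by move=> *; apply: corners_overlap_near1; rewrite ?l29.
Qed.

Theorem theorem1p1 (R : realType) (lam : R) (h0 : 0 < lam) (h1 : lam < 2^-1) :
  [/\ ~ self_similar (cantorF2 lam),
      (3^-1 <= lam -> setK_lam lam = set0) &
      ((2 - Num.sqrt 2) / 2 <= lam ->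
         exists a b : R, a < b /\ `[a, b] `<=` setD_lam lam)].
Proof.
have l01 : 0 < lam < 2^-1 by rewrite h0.
split=> [|l3|lsq].
- exact: cantorF2_not_self_similar.
- apply/seteqP; split=> // k [k0]; case.
  by apply: setD_lam_ge0; rewrite ?l3.
- apply: setD_lam_interval; rewrite h1 andbT; apply: le_trans lsq.
  (* This puts the threshold [(2 - Num.sqrt 2) / 2] above the rational bound [29 / 100]. *)
  have : Num.sqrt 2 <= 142 / 100 :> R.
    rewrite -(@ler_pXn2r _ 2) ?nnegrE ?sqrtr_ge0 ?divr_ge0//.
    by rewrite sqr_sqrtr//; lra.
  lra.
Qed.
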